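(* Let $A\in\mathbb{C}^{m\times n}$, $W\in\mathbb{C}^{n\times m}$ with $\mathrm{ind}(WA)=k$. Then the $W$-weighted core-EP inverse $A^{\mathrm{cEP},W}$ of $A$ is the inverse of $WAW$ along $A(WA)^k[(WA)^k]^*$.
   Context: For a square complex matrix $B$, $\mathrm{ind}(B)$ is the smallest non-negative integer $j$ with $\mathrm{rank}(B^j)=\mathrm{rank}(B^{j+1})$ (with $B^0=I$). $B^*$, $B^{\dagger}$, $\mathcal{R}_s(B)$ and $\mathcal{R}(B)$ denote the conjugate transpose, Moore-Penrose inverse, row space and range (column space) of $B$. For $A\in\mathbb{C}^{m\times n}$, $W\in\mathbb{C}^{n\times m}$ and $p=\max\{\mathrm{ind}(AW),\mathrm{ind}(WA)\}$, the $W$-weighted core-EP inverse $A^{\mathrm{cEP},W}$ is the unique $Y\in\mathbb{C}^{m\times n}$ with $WAWY=(WA)^p[(WA)^p]^{\dagger}$ and $\mathcal{R}(Y)\subseteq\mathcal{R}((AW)^p)$. For $M\in\mathbb{C}^{n\times m}$ and $D,X\in\mathbb{C}^{m\times n}$, $X$ is the inverse of $M$ along $D$ if $XMD=D=DMX$, $\mathcal{R}_s(X)\subseteq\mathcal{R}_s(D)$ and $\mathcal{R}(X)\subseteq\mathcal{R}(D)$. *)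

(* Defs.v *)
From mathcomp Require Import all_boot all_order all_algebra.

Set Implicit Arguments.
Unset Strict Implicit.
Unset Printing Implicit Defensive.

Import Order.TTheory GRing.Theory Num.Theory.

Local Open Scope ring_scope.
Local Open Scope sesquilinear_scope.

Section MatrixIndex.
Variable F : fieldType.

Lemma mxindex_exists n (B : 'M[F]_n) : exists j, \rank (B ^+ j) == \rank (B ^+ j.+1).
Proof.
suff /existsP[j ?] : [exists j : 'I_n.+1, \rank (B ^+ j) == \rank (B ^+ j.+1)].
  by exists j.
apply: contraT; rewrite negb_exists => /forallP neq.
have le j : (j <= n.+1)%N -> (\rank (B ^+ j) + j <= n)%N.
  elim: j => [_|j IHj ltj]; first by rewrite addn0 rank_leq_row.
  apply: leq_trans (IHj (ltnW ltj)); rewrite addnS -addSn leq_add2r.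
  have:= neq (Ordinal ltj); rewrite /= ltn_neqAle eq_sym => -> /=.
  by rewrite exprS -mulmxE mxrankS // submxMl.
by have:= le _ (leqnn _); rewrite addnS ltnNge leq_addl.
Qed.

(* B ^+ 0 = 1, so the index of an invertible matrix is 0. *)
Definition mxindex n (B : 'M[F]_n) : nat := ex_minn (mxindex_exists B).

End MatrixIndex.

Section GeneralizedInverses.
Variable C : numClosedFieldType.

Definition is_mpinv m n (B : 'M[C]_(m, n)) (X : 'M[C]_(n, m)) : bool :=
  [&& B *m X *m B == B, X *m B *m X == X,
      (B *m X)^t* == B *m X & (X *m B)^t* == X *m B].

Lemma adjmxM m n p (A : 'M[C]_(m, n)) (B : 'M[C]_(n, p)) :
  (A *m B)^t* = B^t* *m A^t*.
Proof. by rewrite trmx_mul map_mxM. Qed.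

Lemma adjmxV n (A : 'M[C]_n) : (invmx A)^t* = invmx (A^t*).
Proof. by rewrite trmx_inv map_invmx. Qed.

Lemma mulmx_adj_eq0 m n (A : 'M[C]_(m, n)) : A *m A^t* = 0 -> A = 0.
Proof.
move=> A0; apply/matrixP => i j; rewrite [RHS]mxE.
have /eqP: \sum_k `|A i k| ^+ 2 = 0.
  transitivity ((A *m A^t*) i i); last by rewrite A0 mxE.
  by rewrite mxE; apply: eq_bigr => k _; rewrite !mxE normCK.
rewrite psumr_eq0; last by move=> k _; rewrite exprn_ge0.
by move=> /allP/(_ j (mem_index_enum j))/=; rewrite sqrf_eq0 normr_eq0 => /eqP.
Qed.

Lemma row_free_gram_unit m n (G : 'M[C]_(m, n)) :
  row_free G -> G *m G^t* \in unitmx.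
Proof.
move=> Gfree; rewrite -row_free_unit -kermx_eq0; apply/eqP.
set K := kermx _; apply: (row_free_inj Gfree); rewrite mul0mx.
by apply: mulmx_adj_eq0; rewrite adjmxM mulmxA -(mulmxA K) mulmx_ker mul0mx.
Qed.

Lemma mpinv_exists m n (B : 'M[C]_(m, n)) : exists X, is_mpinv B X.
Proof.
have [r [F [G [Ffull Gfree ->]]]] : exists r (F : 'M[C]_(m, r)) (G : 'M_(r, n)),
    [/\ row_full F, row_free G & B = F *m G].
  exists (\rank B), (col_base B), (row_base B).
  by rewrite col_base_full row_base_free mulmx_base.
have uG := row_free_gram_unit Gfree.
have uF : F^t* *m F \in unitmx.
  rewrite -{2}[F]trmxCK; apply: row_free_gram_unit.
  by rewrite /row_free mxrank_map mxrank_tr.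
exists (G^t* *m invmx (G *m G^t*) *m (invmx (F^t* *m F) *m F^t*)).
set X := (X in is_mpinv _ X).
have BX : F *m G *m X = F *m invmx (F^t* *m F) *m F^t*.
  by rewrite /X -!mulmxA (mulmxA G) (mulmxA (_ *m _) (invmx _)) mulmxV // mul1mx.
have XB : X *m (F *m G) = G^t* *m invmx (G *m G^t*) *m G.
  by rewrite /X -!mulmxA (mulmxA (F^t* )) (mulmxA (invmx _) (_ *m _)) mulVmx // mul1mx.
apply/and4P; split; apply/eqP.
- by rewrite BX -!mulmxA (mulmxA (F^t* )) (mulmxA (invmx _)) mulVmx // mul1mx.
- by rewrite XB /X -!mulmxA (mulmxA G) (mulmxA (_ *m _) (invmx _)) mulmxV // mul1mx.
- by rewrite BX !adjmxM adjmxV !adjmxM !trmxCK mulmxA.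
- by rewrite XB !adjmxM adjmxV !adjmxM !trmxCK mulmxA.
Qed.

Lemma mpinv_uniq m n (B : 'M[C]_(m, n)) X Y :
  is_mpinv B X -> is_mpinv B Y -> X = Y.
Proof.
case/and4P=> /eqP B1 /eqP X1 /eqP BX /eqP XB.
case/and4P=> /eqP B2 /eqP Y1 /eqP BY /eqP YB.
have eqB : B *m X = B *m Y.
  by rewrite -BX -{1}B2 -(mulmxA _ B) adjmxM BX BY mulmxA B1.
have eqB' : X *m B = Y *m B.
  by rewrite -XB -{1}B2 -!mulmxA mulmxA adjmxM XB YB -!mulmxA (mulmxA B) B1.
by rewrite -X1 eqB' -mulmxA eqB mulmxA Y1.
Qed.

Definition mpinv m n (B : 'M[C]_(m, n)) : 'M[C]_(n, m) := xchoose (mpinv_exists B).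

Lemma mpinvP m n (B : 'M[C]_(m, n)) : is_mpinv B (mpinv B).
Proof. exact: xchooseP. Qed.

(* [<=%MS] compares row spaces, so inclusions of ranges (column spaces) are
   stated on transposes, here and in [inverse_along]. *)
Definition is_wcEP m n (A : 'M[C]_(m, n)) (W : 'M[C]_(n, m)) (Y : 'M[C]_(m, n)) : bool :=
  let p := maxn (mxindex (A *m W)) (mxindex (W *m A)) in
  (W *m A *m W *m Y == (W *m A) ^+ p *m mpinv ((W *m A) ^+ p))
  && (Y^T <= ((A *m W) ^+ p)^T)%MS.

Lemma rank_stable n (B : 'M[C]_n) p : (mxindex B <= p)%N ->
  \rank (B ^+ p.+2) = \rank (B ^+ p).
Proof.
have step q : \rank (B ^+ q) = \rank (B ^+ q.+1) ->
              \rank (B ^+ q.+1) = \rank (B ^+ q.+2).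
  move=> eq_rk; have sub : (B ^+ q.+1 <= B ^+ q)%MS by rewrite exprS -mulmxE submxMl.
  have /submxP[T defT] : (B ^+ q <= B ^+ q.+1)%MS.
    by have:= mxrank_leqif_sup sub; rewrite /= -eq_rk => -[_ <-].
  have defS : B ^+ q.+1 = T *m B ^+ q.+2.
    by rewrite (exprSr B q.+1) -mulmxE mulmxA -defT mulmxE -exprSr.
  apply/eqP; rewrite eqn_leq; apply/andP; split; apply: mxrankS.
    by rewrite {1}defS submxMl.
  by rewrite [X in (X <= _)%MS]exprS -mulmxE submxMl.
have base : \rank (B ^+ mxindex B) = \rank (B ^+ (mxindex B).+1).
  by rewrite /mxindex; case: ex_minnP => j /eqP.
move/subnKC <-; set d := (p - _)%N.
have all_eq e : \rank (B ^+ (mxindex B + e)) = \rank (B ^+ (mxindex B + e).+1).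
  by elim: e => [|e IHe]; rewrite ?addn0 // addnS; apply: step.
by rewrite (all_eq d) (step _ (all_eq d)).
Qed.

Lemma mxpow_stable_row n (B : 'M[C]_n) p : (mxindex B <= p)%N ->
  exists T, B ^+ p = T *m B ^+ p.+2.
Proof.
move=> /rank_stable eq_rk; apply/submxP.
have sub : (B ^+ p.+2 <= B ^+ p)%MS by rewrite -addn2 addnC exprD -mulmxE submxMl.
by have:= mxrank_leqif_sup sub; rewrite /= eq_rk => -[_ <-].
Qed.

Lemma mxpow_stable_col n (B : 'M[C]_n) p : (mxindex B <= p)%N ->
  exists T, B ^+ p = B ^+ p.+2 *m T.
Proof.
move=> /rank_stable eq_rk.
have sub : ((B ^+ p.+2)^T <= (B ^+ p)^T)%MS.
  by rewrite -addn2 exprD -mulmxE trmx_mul submxMl.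
have /submxP[T defT] : ((B ^+ p)^T <= (B ^+ p.+2)^T)%MS.
  by have:= mxrank_leqif_sup sub; rewrite /= !mxrank_tr eq_rk => -[_ <-].
by exists T^T; rewrite -[LHS]trmxK defT trmx_mul trmxK.
Qed.

Lemma mulmx_expr_swap m n (A : 'M[C]_(m, n)) (W : 'M[C]_(n, m)) p :
  W *m (A *m W) ^+ p = (W *m A) ^+ p *m W.
Proof.
elim: p => [|p IHp]; first by rewrite !expr0 mulmx1 mul1mx.
by rewrite !exprSr -!mulmxE mulmxA IHp -!mulmxA.
Qed.

Lemma wcEP_exists m n (A : 'M[C]_(m, n)) (W : 'M[C]_(n, m)) : exists Y, is_wcEP A W Y.
Proof.
rewrite /is_wcEP; set p := maxn _ _.
have [T defT] : exists T, (W *m A) ^+ p = (W *m A) ^+ p.+2 *m T.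
  by apply: mxpow_stable_col; rewrite leq_maxr.
have defWA : W *m A *m W *m (A *m W) ^+ p *m A = (W *m A) ^+ p.+2.
  rewrite -(mulmxA (W *m A)) mulmx_expr_swap mulmxA -mulmxA.
  by rewrite exprSr exprS -!mulmxE.
exists ((A *m W) ^+ p *m A *m T *m mpinv ((W *m A) ^+ p)).
apply/andP; split; last by rewrite -!mulmxA trmx_mul submxMl.
by rewrite !mulmxA defWA -defT.
Qed.

Lemma wcEP_uniq m n (A : 'M[C]_(m, n)) (W : 'M[C]_(n, m)) Y Z :
  is_wcEP A W Y -> is_wcEP A W Z -> Y = Z.
Proof.
rewrite /is_wcEP; set p := maxn _ _.
have [T defT] : exists T, (A *m W) ^+ p = T *m (A *m W) ^+ p.+2.
  by apply: mxpow_stable_row; rewrite leq_maxl.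
case/andP=> /eqP Y1 /submxP[S defY]; case/andP=> /eqP Z1 /submxP[U defZ].
have {}defY : Y = (A *m W) ^+ p *m S^T by rewrite -[Y]trmxK defY trmx_mul trmxK.
have {}defZ : Z = (A *m W) ^+ p *m U^T by rewrite -[Z]trmxK defZ trmx_mul trmxK.
have : A *m (W *m A *m W *m Y) = A *m (W *m A *m W *m Z) by rewrite Y1 Z1.
have E V : A *m (W *m A *m W *m ((A *m W) ^+ p *m V)) = (A *m W) ^+ p.+2 *m V.
  by rewrite !exprS -!mulmxE -!mulmxA.
by rewrite defY defZ !E => eqV; rewrite defT -2!(mulmxA T) eqV.
Qed.

Definition wcEP m n (A : 'M[C]_(m, n)) (W : 'M[C]_(n, m)) : 'M[C]_(m, n) :=
  xchoose (wcEP_exists A W).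

Lemma wcEPP m n (A : 'M[C]_(m, n)) (W : 'M[C]_(n, m)) : is_wcEP A W (wcEP A W).
Proof. exact: xchooseP. Qed.

Definition inverse_along m n (M : 'M[C]_(n, m)) (D X : 'M[C]_(m, n)) : Prop :=
  [/\ X *m M *m D = D, D = D *m M *m X, (X <= D)%MS & (X^T <= D^T)%MS].

End GeneralizedInverses.

(* Main.v *)
Require Import Defs.
From mathcomp Require Import all_boot all_order all_algebra.
From mathcomp Require Import complex reals.

(** Put B = WA, G = AW, let p be the larger of the indices of B and G, and let
    Y be the weighted core-EP inverse.  So WAWY = P, where
    P = B^p (B^p)^+ is the orthogonal projector onto the range of B^p, and the
    range of Y lies in that of G^p.  Two facts carry the proof.

    - Since p >= k = ind B, the powers B^k and B^p have the same range
      ([mxpow_range_stable]).  Hence P fixes B^k, and as P is Hermitian,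
      (B^k)^* P = (B^k)^* and P is a left multiple of (B^k)^*.
    - WAW is injective on the range of G^p, because A(WAW) = G^2 and
      p >= ind G ([weighted_cancel]).

    Cancelling WAW in WAWYB^(k+2) = P B^(k+2) = B^(k+2) = WAW(AB^k) gives
    YB^(k+2) = AB^k ([wcEP_mul_pow]), hence YMD = D for M = WAW and
    D = AB^k(B^k)^*; cancelling it in WAWYP = P = WAWY gives YP = Y
    ([wcEP_core_proj]).  The identity DMY = D is (B^k)^* P = (B^k)^*.  For the
    two inclusions, H = H H^* (H^+)^* and H^* = H^+ H H^*, taken at H = B^k,
    show that D has the range of AB^k and the row space of (B^k)^*: the former
    contains the range of G^p, hence that of Y, and the latter contains the
    rows of P, hence those of YP = Y. *)

Set Implicit Arguments.
Unset Strict Implicit.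
Unset Printing Implicit Defensive.

Import GRing.Theory.

Local Open Scope ring_scope.
Local Open Scope complex_scope.
Local Open Scope sesquilinear_scope.

Section MoorePenroseGram.
Variable C : numClosedFieldType.

Lemma mulmx_adj_mpinv m n (H : 'M[C]_(m, n)) : H *m H^t* *m (mpinv H)^t* = H.
Proof.
case/and4P: (mpinvP H) => /eqP HXH _ _ /eqP herm.
by rewrite -mulmxA -adjmxM herm mulmxA.
Qed.

Lemma mpinv_mulmx_adj m n (H : 'M[C]_(m, n)) : mpinv H *m H *m H^t* = H^t*.
Proof.
case/and4P: (mpinvP H) => /eqP HXH _ _ /eqP herm.
by rewrite -{1}herm -adjmxM mulmxA HXH.
Qed.

End MoorePenroseGram.

Section StablePowers.
Variable C : numClosedFieldType.

(** Beyond the index the ranges of the powers no longer shrink: inductively,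
    B^k = B^d B^k T with B^k = B^(k+2) U yields B^k = B^(k+d+1) (BUT). *)
Lemma mxpow_range_stable n (B : 'M[C]_n) p :
  (mxindex B <= p)%N -> exists T, B ^+ mxindex B = B ^+ p *m T.
Proof.
move/subnKC <-; set k := mxindex B; elim: (p - k)%N => [|d [T IHd]].
  by exists 1%:M; rewrite addn0 mulmx1.
have [U defU] := mxpow_stable_col (leqnn k).
have E : B ^+ (k + d.+1) *m B = B ^+ d *m B ^+ k.+2.
  by rewrite !mulmxE -exprSr -exprD !addnS addnC.
exists (B *m U *m T); rewrite !mulmxA E -(mulmxA _ _ U) -defU.
by rewrite mulmxE -exprD addnC.
Qed.

(** Left multiplication by A turns (WAW)(AW)^p into (AW)^(p+2), which has the
    same kernel as (AW)^p once p >= ind (AW). *)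
Lemma weighted_cancel m n r (A : 'M[C]_(m, n)) (W : 'M[C]_(n, m)) p
    (U V : 'M[C]_(m, r)) :
  (mxindex (A *m W) <= p)%N ->
  W *m A *m W *m ((A *m W) ^+ p *m U) = W *m A *m W *m ((A *m W) ^+ p *m V) ->
  (A *m W) ^+ p *m U = (A *m W) ^+ p *m V.
Proof.
move=> /mxpow_stable_row[T defT] /(congr1 (mulmx A)).
have E X : A *m (W *m A *m W *m ((A *m W) ^+ p *m X)) = (A *m W) ^+ p.+2 *m X.
  by rewrite !exprS -!mulmxE -!mulmxA.
by rewrite !E => eqUV; rewrite defT -2!(mulmxA T) eqUV.
Qed.

End StablePowers.

Section WeightedCoreEP.
Variables (C : numClosedFieldType) (m n : nat).
Variables (A : 'M[C]_(m, n)) (W : 'M[C]_(n, m)).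

Let k := mxindex (W *m A).
Let p := maxn (mxindex (A *m W)) (mxindex (W *m A)).
Let P := (W *m A) ^+ p *m mpinv ((W *m A) ^+ p).
Let Bk := (W *m A) ^+ k.
Let D := A *m Bk *m Bk^t*.

Let leAW : (mxindex (A *m W) <= p)%N. Proof. exact: leq_maxl. Qed.
Let leWA : (k <= p)%N. Proof. exact: leq_maxr. Qed.

Lemma mulmx_expr_swapr q : A *m (W *m A) ^+ q = (A *m W) ^+ q *m A.
Proof. exact: mulmx_expr_swap. Qed.

Lemma wcEP_proj : W *m A *m W *m wcEP A W = P.
Proof. by case/andP: (wcEPP A W) => /eqP. Qed.

Lemma wcEP_range : exists S, wcEP A W = (A *m W) ^+ p *m S.
Proof.
case/andP: (wcEPP A W) => _ /submxP[S defY].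
by exists S^T; rewrite -[LHS]trmxK defY trmx_mul trmxK.
Qed.

Lemma core_proj_herm : P^t* = P.
Proof. by case/and4P: (mpinvP ((W *m A) ^+ p)) => _ _ /eqP. Qed.

Lemma core_projK : P *m P = P.
Proof.
case/and4P: (mpinvP ((W *m A) ^+ p)) => /eqP defB _ _ _.
by rewrite /P mulmxA defB.
Qed.

Lemma core_proj_pow : P *m Bk = Bk.
Proof.
case/and4P: (mpinvP ((W *m A) ^+ p)) => /eqP defB _ _ _.
by have [T defT] := mxpow_range_stable leWA; rewrite /Bk {}defT mulmxA defB.
Qed.

Lemma pow_adj_core_proj : Bk^t* *m P = Bk^t*.
Proof. by rewrite -{1}core_proj_herm -adjmxM core_proj_pow. Qed.

(** P = B^k B^(p-k) (B^p)^+ is Hermitian, so it equals the adjoint of this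
    product; this bounds the row space of P by that of (B^k)^*. *)
Lemma core_proj_factor : exists Z, P = Z *m Bk^t*.
Proof.
exists (((W *m A) ^+ (p - k) *m mpinv ((W *m A) ^+ p))^t* ).
by rewrite -adjmxM mulmxA mulmxE -exprD subnKC // core_proj_herm.
Qed.

Lemma weighted_mul_pow q :
  W *m A *m W *m (A *m (W *m A) ^+ q) = (W *m A) ^+ q.+2.
Proof. by rewrite !exprS -!mulmxE -!mulmxA. Qed.

(** WAW sends both sides to P, since P is idempotent, and both have range
    inside that of (AW)^p. *)
Lemma wcEP_core_proj : wcEP A W *m P = wcEP A W.
Proof.
have [S defY] := wcEP_range.
rewrite {1}defY [RHS]defY -mulmxA; apply: weighted_cancel leAW _.
by rewrite (mulmxA _ S) -defY mulmxA wcEP_proj core_projK.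
Qed.

(** WAW sends both sides to B^(k+2).  That AB^k, too, has range inside that of
    (AW)^p rests on B^k = B^p T and AB^p = (AW)^p A. *)
Lemma wcEP_mul_pow : wcEP A W *m (W *m A) ^+ k.+2 = A *m Bk.
Proof.
have [S defY] := wcEP_range; have [T defT] := mxpow_range_stable leWA.
have defAB : A *m Bk = (A *m W) ^+ p *m (A *m T).
  by rewrite /Bk {1}defT mulmxA mulmx_expr_swapr -mulmxA.
rewrite defAB {1}defY -mulmxA; apply: weighted_cancel leAW _.
rewrite -defAB weighted_mul_pow (mulmxA _ S) -defY mulmxA wcEP_proj.
by rewrite -addn2 exprD -mulmxE mulmxA core_proj_pow.
Qed.

(** Applying WAW to D gives B^(k+2) (B^k)^*; index stability lowers the exponent
    to k, and the Moore-Penrose inverse of B^k then removes B^k. *)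
Lemma pow_adj_sub_along : (Bk^t* <= D)%MS.
Proof.
have [T defT] := mxpow_stable_row (leqnn k).
apply/submxP; exists (mpinv Bk *m T *m (W *m A *m W)).
rewrite -(mulmxA (mpinv Bk *m T)) /D (mulmxA _ (A *m Bk)) weighted_mul_pow.
by rewrite mulmxA -(mulmxA _ T) -defT mpinv_mulmx_adj.
Qed.

(** D (H^+)^* = A H for H = B^k, and (AW)^p = (AW)^(p+2) T = A B^(p+1) W T, where
    B^(p+1) starts with B^k. *)
Lemma range_pow_sub_along : exists Z, (A *m W) ^+ p = D *m Z.
Proof.
have [T defT] := mxpow_stable_col leAW.
have E : D *m (mpinv Bk)^t* = A *m Bk.
  by rewrite /D -!(mulmxA A) mulmx_adj_mpinv.
have powD : Bk *m (W *m A) ^+ (p - k).+1 = (W *m A) ^+ p.+1.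
  by rewrite mulmxE -exprD addnS subnKC.
exists ((mpinv Bk)^t* *m (W *m A) ^+ (p - k).+1 *m W *m T).
rewrite !mulmxA E -(mulmxA A) powD mulmx_expr_swapr -(mulmxA _ A W).
by rewrite mulmxE -exprSr.
Qed.

Lemma wcEP_inverse_along : inverse_along (W *m A *m W) D (wcEP A W).
Proof.
split.
- rewrite -mulmxA /D (mulmxA (W *m A *m W)) weighted_mul_pow mulmxA.
  by rewrite wcEP_mul_pow.
- by rewrite -(mulmxA D) wcEP_proj /D -(mulmxA (A *m Bk)) pow_adj_core_proj.
- have [Z defP] := core_proj_factor.
  by rewrite -wcEP_core_proj defP mulmxA mulmx_sub ?pow_adj_sub_along.
- have [S ->] := wcEP_range; have [Z ->] := range_pow_sub_along.
  by rewrite -mulmxA trmx_mul submxMl.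
Qed.

End WeightedCoreEP.

Theorem theorem4p4 (R : realType) (m n k : nat)
    (A : 'M[R[i]]_(m, n)) (W : 'M[R[i]]_(n, m)) :
  mxindex (W *m A) = k ->
  inverse_along (W *m A *m W) (A *m (W *m A) ^+ k *m ((W *m A) ^+ k)^t* )
    (wcEP A W).
Proof. by move=> <-; exact: wcEP_inverse_along. Qed.
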